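(* For any $m_1,m_2\in\mathbb{N}$ with $m=\operatorname{lcm}(m_1,m_2)$ and any $a\in\mathbb{Z}$, $$\frac1m\sum_{\substack{k,\ell\ (\mathrm{mod}\ m)\\ \gcd(\ell,m)=1}}c_{m_1}(k)\,c_{m_2}(k+\ell-a)=\begin{cases}\mu(m)c_m(a), & m_1=m_2=m,\\ 0,&\text{otherwise},\end{cases}$$ where $k$ and $\ell$ run over residues modulo $m$.
   Context: For $n\in\mathbb{N}$ and $k\in\mathbb{Z}$, $c_n(k)=\sum_{1\le j\le n,\ \gcd(j,n)=1}\exp(2\pi i jk/n)$ is the Ramanujan sum. $\mu$ is the Möbius function. *)

(* Defs.v *)
From HB Require Import structures.
From mathcomp Require Import all_boot all_order all_algebra.
From mathcomp Require Import complex.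
From mathcomp Require Import reals sequences exp trigo.
Set Implicit Arguments.
Unset Strict Implicit.
Unset Printing Implicit Defensive.
Import Order.TTheory GRing.Theory Num.Theory.
Local Open Scope ring_scope.
Local Open Scope complex_scope.

Definition cexp (R : realType) (z : R[i]) : R[i] :=
  (expR (complex.Re z))%:C * (cos (complex.Im z) +i* sin (complex.Im z)).

Definition ramanujan_sum (R : realType) (n : nat) (k : int) : R[i] :=
  \sum_(1 <= j < n.+1 | coprime j n)
     cexp (2%:R * (pi : R)%:C * 'i * j%:R * k%:~R / n%:R).

Definition squarefree (n : nat) : bool :=
  (0 < n)%N && all (fun p => ~~ (p ^ 2 %| n)%N) (primes n).

Definition mobius (n : nat) : int :=
  if squarefree n then (-1) ^+ size (primes n) else 0.

(* Main.v *)
Require Import Defs.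
From HB Require Import structures.
From mathcomp Require Import all_boot all_order all_algebra.
From mathcomp Require Import complex.
From mathcomp Require Import reals sequences exp trigo.
From mathcomp Require Import ring lra zify.
Import Order.TTheory GRing.Theory Num.Theory.
Local Open Scope ring_scope.
Local Open Scope complex_scope.
Set Implicit Arguments.
Unset Strict Implicit.
Unset Printing Implicit Defensive.

(** Write [w] for a primitive [m]-th root of unity and [q1 = m / m1],
    [q2 = m / m2], which are coprime.  Expanding both Ramanujan sums, the sum
    over [k] of [w ^ ((j1 q1 + j2 q2) k)] vanishes unless [m] divides
    [j1 q1 + j2 q2]; then [q1] divides [j2] and [m2], hence is [1], and
    likewise [q2 = 1].  So only [m1 = m2 = m] and [j2 = - j1] contribute, and
    there the sum over [l] is a sum of all primitive [m]-th roots of unity,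
    that is [mobius m]. *)

(** * Power sums of a primitive root of unity *)

Section RootsOfUnity.

Variable F : fieldType.

Lemma sum_expr_unity_root (x : F) (n : nat) :
  x ^+ n = 1 -> \sum_(k < n) x ^+ k = if x == 1 then n%:R else 0.
Proof.
move=> xn; case: eqP => [->|/eqP x1].
  by under eq_bigr do rewrite expr1n; rewrite sumr_const card_ord.
have := subrX1 x n; rewrite xn subrr => /esym/eqP.
by rewrite mulf_eq0 subr_eq0 (negbTE x1) => /eqP.
Qed.

Lemma sum_multiples (V : nmodType) (G : nat -> V) (d e : nat) : (0 < d)%N ->
  \sum_(0 <= j < d * e | (d %| j)%N) G j = \sum_(i < e) G (d * i)%N.
Proof.
move=> d0; elim: e => [|e IHe]; first by rewrite muln0 big_geq // big_ord0.
rewrite (@big_cat_nat _ _ _ (d * e)%N) ?leq_pmul2l //= IHe big_ord_recr /=.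
(* The block from [d * e] up to [d * e.+1] contains a single multiple of [d], its first element. *)
congr (_ + _); rewrite big_mkcond big_ltn ?ltn_pmul2l // dvdn_mulr //=.
rewrite big_nat_cond big1 ?addr0 // => j /andP[/andP[lej ltj] _].
case: ifP => // /dvdnP[k jE]; move: lej ltj.
by rewrite jE [(k * d)%N]mulnC !ltn_pmul2l // ltnS ltnNge => /negbTE ->.
Qed.

(** The multiples of [d] give a full geometric sum in [z ^+ d]; it vanishes unless [z ^+ d = 1],
    that is [n] divides [d], and then only [j = 0] is left. *)
Lemma sum_prim_root_multiples (z : F) (n d : nat) :
    n.-primitive_root z -> (d %| n)%N ->
  \sum_(0 <= j < n | (d %| j)%N) z ^+ j = (d == n)%:R.
Proof.
move=> zP /dvdnP[e nE]; have n0 := prim_order_gt0 zP.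
have d0 : (0 < d)%N by move: n0; rewrite nE muln_gt0 => /andP[].
rewrite {1}nE mulnC sum_multiples //.
under eq_bigr do rewrite exprM.
rewrite sum_expr_unity_root; last first.
  by rewrite -exprM mulnC -nE prim_expr_order.
rewrite -(prim_order_dvd zP).
case: (d =P n) => [dn|dn].
  rewrite dn dvdnn; suff -> : e = 1%N by [].
  by move/eqP: nE; rewrite dn -{1}[n]mul1n eqn_pmul2r // => /eqP.
case: ifP => // nd; case: dn; apply/eqP; rewrite eqn_dvd nd andbT.
by rewrite nE dvdn_mull.
Qed.

(* Sieving out the primes of [s] one at a time; only the term
   [d * \prod s = n] survives. *)
Lemma sum_prim_root_sieve (z : F) (n : nat) (s : seq nat) (d : nat) :
    n.-primitive_root z -> uniq s -> all prime s -> all (coprime d) s ->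
    (d * \prod_(p <- s) p %| n)%N ->
  \sum_(0 <= j < n | (d %| j)%N && all (fun p => ~~ (p %| j)%N) s) z ^+ j
    = (-1) ^+ size s * (d * \prod_(p <- s) p == n)%N%:R.
Proof.
move=> zP; have n0 := prim_order_gt0 zP; elim: s d => [|p s IHs] d /=.
  move=> _ _ _; rewrite big_nil muln1 mul1r => dn.
  rewrite -(sum_prim_root_multiples zP) //.
  by apply: eq_bigl => j; rewrite andbT.
move=> /andP[ps us] /andP[pp pr] /andP[dp ds]; rewrite big_cons => dn.
have dn' : (d * \prod_(q <- s) q %| n)%N.
  by apply: dvdn_trans dn; rewrite mulnCA dvdn_mull.
(* Without the condition at [p] the sum is zero, since [d * \prod s] is a proper divisor of [n].
   Hence the part with [p] not dividing [j] is minus the part with [p] dividing [j], which is the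
   same sieve for [d * p]. *)
have := IHs d us pr ds dn'.
rewrite (bigID (fun j => p %| j)%N) /=.
have -> : (d * \prod_(q <- s) q == n)%N = false.
  apply/negbTE; apply: contraTneq dn => dn; rewrite mulnCA dn.
  by apply/negP => /(dvdn_leq n0); have := prime_gt1 pp; nia.
rewrite mulr0 => /eqP; rewrite addrC addr_eq0 => /eqP.
under eq_bigl do rewrite -andbA [X in _ && X]andbC.
move=> ->.
under eq_bigl do rewrite andbAC -Gauss_dvd //.
rewrite IHs //.
- by rewrite exprS mulN1r mulNr mulnA.
- apply/allP => q qs; rewrite coprimeMl (allP ds) //=.
  rewrite prime_coprime // dvdn_prime2 ?(allP pr q) //.
  by apply: contraNneq ps => ->.
- by rewrite -mulnA.
Qed.

(** * Coprimality and squarefreeness in terms of prime divisors *)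

Lemma coprime_all_primes (j n : nat) : (0 < n)%N ->
  coprime j n = all (fun p => ~~ (p %| j)%N) (primes n).
Proof.
move=> n0; apply/idP/allP => [cop p|h].
  rewrite mem_primes => /and3P[pp _ pn]; apply/negP => pj.
  have : (p %| gcdn j n)%N by rewrite dvdn_gcd pj.
  by rewrite (eqP cop) dvdn1 => /eqP p1; rewrite p1 in pp.
rewrite /coprime; case: (ltngtP (gcdn j n) 1) => // g.
  by move: g; rewrite ltnS leqNgt gcdn_gt0 n0 orbT.
(* A gcd above 1 has a prime divisor, which lies in [primes n] and divides [j]. *)
have pg := pdiv_dvd (gcdn j n); move: (pg); rewrite dvdn_gcd => /andP[pj pn].
by have := h (pdiv (gcdn j n)); rewrite mem_primes pdiv_prime // n0 pn pj => /(_ isT).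
Qed.

Lemma prod_primes_dvd (n : nat) : (0 < n)%N -> (\prod_(p <- primes n) p %| n)%N.
Proof.
move=> n0; rewrite [X in (_ %| X)%N](prod_prime_decomp n0) prime_decompE big_map /=.
rewrite [X in (X %| _)%N]big_seq [X in (_ %| X)%N]big_seq.
elim/big_ind2: _ => // [? ? ? ? ? ?|p]; first exact: dvdn_mul.
by rewrite -logn_gt0 => lp; exact: dvdn_exp.
Qed.

(** Both sides say that every prime divisor of [n] occurs with exponent 1. *)
Lemma prod_primes_eq (n : nat) : (0 < n)%N ->
  (\prod_(p <- primes n) p == n)%N = squarefree n.
Proof.
move=> n0; rewrite /squarefree n0 /=; apply/eqP/allP => [nE p pn|h].
  have pp : prime p by move: pn; rewrite mem_primes => /andP[].
  rewrite pfactor_dvdn // -ltnNge ltnS -[n in logn p n]nE.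
  rewrite (big_rem p) //= lognM ?(prime_gt0 pp) //; last first.
    rewrite big_seq; elim/big_ind: _ => // [x y x0 y0|q /mem_rem].
      by rewrite muln_gt0 x0.
    by rewrite mem_primes => /and3P[/prime_gt0].
  (* The factor [p] contributes exponent 1; the other factors are primes different from [p], because
     [primes n] has no repetition, and contribute 0. *)
  rewrite logn_prime // eqxx -[leqRHS]addn0 leq_add2l leqn0.
  rewrite lognE pp /=; case: ifP => // /andP[_ pd]; exfalso; move: pd.
  rewrite Euclid_dvd_prod // big_has => /hasP[q].
  rewrite mem_rem_uniq ?primes_uniq // !inE mem_primes => /and4P[qp pq _ _] /=.
  by rewrite dvdn_prime2 // => /eqP pqE; rewrite pqE eqxx in qp.
rewrite [RHS](prod_prime_decomp n0) prime_decompE big_map /=.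
apply: eq_big_seq => p pn; have := h p pn.
have pp : prime p by move: pn; rewrite mem_primes => /andP[].
rewrite pfactor_dvdn // -ltnNge ltnS => l1.
suff -> : logn p n = 1%N by rewrite expn1.
by apply/eqP; rewrite eqn_leq l1 logn_gt0.
Qed.

(** This is the sieve with [d = 1] and [s = primes n]: its condition is coprimality to [n], its sign
    is that of [mobius n], and its indicator is squarefreeness. *)
Lemma sum_prim_roots (z : F) (n : nat) : n.-primitive_root z ->
  \sum_(l < n | coprime l n) z ^+ l = (mobius n)%:~R.
Proof.
move=> zP; have n0 := prim_order_gt0 zP.
under eq_bigl => l do rewrite coprime_all_primes // -[all _ _]andTb -(dvd1n l).
have := @sum_prim_root_sieve z n (primes n) 1 zP (primes_uniq n).
rewrite mul1n prod_primes_dvd // prod_primes_eq // big_mkord => -> //.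
- rewrite /mobius; case: squarefree; last by rewrite mulr0.
  by rewrite mulr1 rmorphXn /= rmorphN1.
- by apply/allP => p; rewrite mem_primes => /andP[].
- by apply/allP => p _; rewrite coprime1n.
Qed.

(** * Convolution of exponential sums over reduced residues *)

Lemma sum_coprime_char_prod (w : F) (m m1 m2 : nat) (a : int) (q1 q2 : nat) :
    m.-primitive_root w ->
  \sum_(k < m) \sum_(l < m | coprime l m)
     (\sum_(j < m1 | coprime j m1) w ^ ((j * q1)%N%:Z * k%:Z)) *
     (\sum_(j < m2 | coprime j m2) w ^ ((j * q2)%N%:Z * (k%:Z + l%:Z - a)))
  = \sum_(j1 < m1 | coprime j1 m1) \sum_(j2 < m2 | coprime j2 m2)
      (if (m %| j1 * q1 + j2 * q2)%N then m%:R else 0) *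
      \sum_(l < m | coprime l m) w ^ ((j2 * q2)%N%:Z * (l%:Z - a)).
Proof.
move=> wP; have w0 : w != 0 by rewrite (prim_root_eq0 wP) -lt0n (prim_order_gt0 wP).
(* Regrouping the exponent as [(j1 q1 + j2 q2) k + j2 q2 (l - a)] separates [k] from [l] and leaves
   a geometric sum over [k]. *)
transitivity (\sum_(k < m) \sum_(l < m | coprime l m)
  \sum_(j1 < m1 | coprime j1 m1) \sum_(j2 < m2 | coprime j2 m2)
    (w ^+ (j1 * q1 + j2 * q2)) ^+ k * w ^ ((j2 * q2)%N%:Z * (l%:Z - a))).
  apply: eq_bigr => k _; apply: eq_bigr => l _.
  rewrite big_distrlr /=; apply: eq_bigr => j1 _; apply: eq_bigr => j2 _.
  rewrite -exprM -expfzDr // exprnP -expfzDr //; congr (_ ^ _).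
  rewrite !PoszM !PoszD !PoszM; ring.
under eq_bigr do rewrite exchange_big /=.
rewrite exchange_big /=; apply: eq_bigr => j1 _.
under eq_bigr do rewrite exchange_big /=.
rewrite exchange_big /=; apply: eq_bigr => j2 _.
rewrite -big_distrlr /= sum_expr_unity_root; last first.
  by rewrite exprAC (prim_expr_order wP) expr1n.
by rewrite -(prim_order_dvd wP).
Qed.

Lemma sum_coprime_char_conv (w : F) (m m1 m2 q1 q2 : nat) (a : int) :
    m.-primitive_root w -> (m1 * q1 = m)%N -> (m2 * q2 = m)%N -> coprime q1 q2 ->
  \sum_(k < m) \sum_(l < m | coprime l m)
     (\sum_(j < m1 | coprime j m1) w ^ ((j * q1)%N%:Z * k%:Z)) *
     (\sum_(j < m2 | coprime j m2) w ^ ((j * q2)%N%:Z * (k%:Z + l%:Z - a)))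
  = if (m1 == m2) && (m2 == m) then
      m%:R * ((mobius m)%:~R * \sum_(j < m | coprime j m) w ^ (j%:Z * a))
    else 0.
Proof.
move=> wP m1E m2E cq; have m0 := prim_order_gt0 wP.
have w0 : w != 0 by rewrite (prim_root_eq0 wP) -lt0n.
rewrite sum_coprime_char_prod //; case: ifP => [/andP[/eqP m12 /eqP m2m]|ne].
  have q21 : q2 = 1%N.
    by apply/eqP; rewrite -(eqn_pmul2l m0) -{1}m2m m2E muln1.
  have q11 : q1 = 1%N.
    by apply/eqP; rewrite -(eqn_pmul2l m0) -{1}m2m -m12 m1E muln1.
  move: m12; rewrite m2m => m1m; subst m1 m2 q1 q2.
  (* For fixed [j1] the only partner is the residue of [- j1]. The reduction modulo [m] covers
     [j1 = 0], which is coprime to [m] when [m = 1]. *)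
  rewrite !mulr_sumr; apply: eq_bigr => j1 cj1.
  have lt2 : ((m - j1) %% m < m)%N by rewrite ltn_pmod.
  have dE (j2 : 'I_m) : (m %| j1 + j2)%N = (j2 == Ordinal lt2).
    apply/idP/eqP => [dv|->]; last first.
      by rewrite /dvdn /= modnDmr subnKC ?modnn // ltnW.
    apply: val_inj => /=; apply/eqP; rewrite -[X in X == _](modn_small (ltn_ord j2)).
    by rewrite -(eqn_modDl j1) subnKC ?modnn // ltnW.
  have c2 : coprime (Ordinal lt2) m.
    have le1 := ltnW (ltn_ord j1).
    rewrite /= coprime_modl /coprime; move: (nat_of_ord j1) le1 cj1 => j le1 cj1.
    by rewrite -[X in gcdn _ X](subnK le1) gcdnDl gcdnC -gcdnDr subnK.
  rewrite (bigD1 (Ordinal lt2)) //= [X in _ + X]big1; last first.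
    by move=> j2 /andP[_ ne2]; rewrite !muln1 dE (negbTE ne2) mul0r.
  rewrite addr0; set j2 := Ordinal lt2 in c2 *.
  have := dE j2; rewrite eqxx !muln1 => dv; rewrite dv; congr (_ * _).
  (* As [j2] is coprime to [m], [w ^+ j2] is again a primitive root, so the sum over [l] yields
     [mobius m]. *)
  rewrite -(@sum_prim_roots (w ^+ j2)); last first.
    by rewrite prim_root_exp_coprime.
  rewrite mulr_suml; apply: eq_bigr => l _.
  (* The leftover factor [w ^ (- j2 a)] is the [j1] term of the target sum, since
     [w ^ (j1 + j2) = 1]. *)
  have wE : w ^ (j1%:Z * a) = w ^ (- (j2%:Z * a)).
    apply: (mulIf (expfz_neq0 (j2%:Z * a) w0)).
    rewrite -!expfzDr // addNr expr0z -mulrDl -PoszD -exprz_exp -exprnP.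
    by move: dv; rewrite (prim_order_dvd wP) => /eqP ->; rewrite exp1rz.
  rewrite wE -exprM exprnP -expfzDr //; congr (_ ^ _).
  rewrite PoszM; ring.
(* A nonvanishing term would force [q1 = q2 = 1], hence [m1 = m2 = m], the excluded case. *)
rewrite big1 // => j1 c1; rewrite big1 // => j2 c2.
case: ifP => [dv|]; rewrite ?mul0r //; exfalso.
have q11 : q1 = 1%N.
  have h : (q1 %| j2)%N.
    rewrite -(Gauss_dvdl _ cq) -(dvdn_addr _ (dvdn_mull j1 (dvdnn q1))).
    by apply: dvdn_trans dv; rewrite -m1E dvdn_mull.
  have h' : (q1 %| m2)%N by rewrite -(Gauss_dvdl _ cq) m2E -m1E dvdn_mull.
  have : (q1 %| gcdn j2 m2)%N by rewrite dvdn_gcd h.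
  by rewrite (eqP c2) dvdn1 => /eqP.
have q21 : q2 = 1%N.
  move: cq; rewrite coprime_sym => cq.
  have h : (q2 %| j1)%N.
    rewrite -(Gauss_dvdl _ cq) -(dvdn_addl _ (dvdn_mull j2 (dvdnn q2))).
    by apply: dvdn_trans dv; rewrite -m2E dvdn_mull.
  have h' : (q2 %| m1)%N by rewrite -(Gauss_dvdl _ cq) m1E -m2E dvdn_mull.
  have : (q2 %| gcdn j1 m1)%N by rewrite dvdn_gcd h.
  by rewrite (eqP c1) dvdn1 => /eqP.
by move: ne; rewrite -m2E -{1}[m1]muln1 -q11 m1E -m2E q21 muln1 !eqxx.
Qed.

End RootsOfUnity.

(** * The complex exponential as a source of primitive roots of unity *)

Section ComplexExponential.

Variable R : realType.
Implicit Types (x y : R[i]) (n : nat) (k : int).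

Lemma cexpD x y : cexp (x + y) = cexp x * cexp y.
Proof.
case: x y => [a b] [c d]; rewrite /cexp /= expRD cosD sinD.
by apply/eqP; rewrite eq_complex /=; apply/andP; split; apply/eqP; ring.
Qed.

Lemma cexp0 : cexp (0 : R[i]) = 1.
Proof.
by rewrite /cexp /= expR0 cos0 sin0 mul1r.
Qed.

Lemma cexp_neq0 x : cexp x != 0.
Proof.
apply/negP => /eqP x0; have := cexp0; rewrite -(subrr x) cexpD x0 mul0r.
by move/eqP; rewrite eq_sym oner_eq0.
Qed.

Lemma cexpMn x n : cexp (x * n%:R) = cexp x ^+ n.
Proof.
elim: n => [|n IHn]; first by rewrite mulr0 cexp0.
by rewrite exprSr -IHn -cexpD -natr1 mulrDr mulr1.
Qed.

Lemma cexpN x : cexp (- x) = (cexp x)^-1.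
Proof.
by apply: (mulIf (cexp_neq0 x)); rewrite mulVf ?cexp_neq0 // -cexpD addNr cexp0.
Qed.

Lemma cexpMz x k : cexp (x * k%:~R) = cexp x ^ k.
Proof.
case: k => n; first exact: cexpMn.
by rewrite NegzE mulrNz mulrN cexpN cexpMn exprnN.
Qed.

Lemma cexp_real_imag (t : R) : cexp ('i * t%:C) = cos t +i* sin t.
Proof. by rewrite /cexp /= !(mul0r, mulr0, mul1r, addr0, oppr0, add0r) expR0 mul1r.
Qed.

(** For [0 < i < n] the [i]-th power has real part [1 - 2 sin(pi i / n)^2], which is below 1 because
    the sine is positive strictly between 0 and [pi]. *)
Lemma cexp_prim_root n : (0 < n)%N ->
  n.-primitive_root (cexp (2%:R * (pi : R)%:C * 'i / n%:R)).
Proof.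
move=> n0; have nR0 : (n%:R : R) != 0 by rewrite pnatr_eq0 -lt0n.
have wE i : cexp (2%:R * (pi : R)%:C * 'i / n%:R) ^+ i =
    cos (pi * (i%:R / n%:R) *+ 2) +i* sin (pi * (i%:R / n%:R) *+ 2).
  rewrite -cexpMn -cexp_real_imag; congr cexp.
  rewrite !(rmorphM, rmorphMn, fmorphV, rmorph_nat) /= -mulr_natl.
  by ring.
rewrite /primitive_root_of_unity n0; apply/forallP => i.
rewrite unity_rootE wE; case: (i.+1 =P n) => [->|/eqP ne].
  by rewrite divff // mulr1 cos2pi sin2pi eqxx.
have lt : (i.+1 < n)%N by rewrite ltn_neqAle ne ltn_ord.
have s0 : 0 < sin (pi * (i.+1%:R / n%:R) : R).
  apply: sin_gt0_pi; rewrite mulr_gt0 ?pi_gt0 ?divr_gt0 ?ltr0n //=.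
  by rewrite gtr_pMr ?pi_gt0 // ltr_pdivrMr ?ltr0n // mul1r ltr_nat.
apply/eqP/negbTE; rewrite eq_complex /= negb_and; apply/orP; left.
rewrite cos_mulr2n cos2sin2; apply/eqP => h.
have : 0 < sin (pi * (i.+1%:R / n%:R) : R) ^+ 2 by rewrite exprn_gt0.
lra.
Qed.

(** The free factor [q] allows Ramanujan sums of different moduli to be written in powers of one
    root, of common order [n * q]. *)
Lemma ramanujan_sum_prim_root n q k : (0 < n)%N -> (0 < q)%N ->
  ramanujan_sum R n k =
  \sum_(j < n | coprime j n)
    cexp (2%:R * (pi : R)%:C * 'i / (n * q)%:R) ^ ((j * q)%N%:Z * k).
Proof.
move=> n0 q0; set w := cexp _.
have nR0 : (n%:R : R[i]) != 0 by rewrite pnatr_eq0 -lt0n.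
have qR0 : (q%:R : R[i]) != 0 by rewrite pnatr_eq0 -lt0n.
rewrite /ramanujan_sum.
under eq_bigr => j _.
  rewrite (_ : cexp _ = w ^ ((j * q)%N%:Z * k)); last first.
    rewrite -cexpMz; congr cexp; rewrite intrM -pmulrn !natrM.
    by field; rewrite nR0 qR0.
  over.
rewrite -(big_mkord (fun j => coprime j n) (fun j => w ^ ((j * q)%N%:Z * k))).
(* The range 1 to [n] is shifted to 0 to [n - 1] by trading [j = n] for [j = 0]: both have gcd [n]
   with [n], and both powers equal 1. *)
rewrite [LHS]big_mkcond [RHS]big_mkcond big_nat_recr //= [RHS]big_ltn //= addrC.
congr (_ + _).
rewrite /coprime gcdnn gcd0n mul0n mul0r expr0z -exprz_exp -exprnP.
by rewrite (prim_expr_order (cexp_prim_root _)) ?muln_gt0 ?n0 // exp1rz.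
Qed.

End ComplexExponential.

(** * The convolution identity for Ramanujan sums *)

Theorem corollary16 (R : realType) (m1 m2 m : nat) (a : int)
    (hm1 : (0 < m1)%N) (hm2 : (0 < m2)%N) (hm : m = lcmn m1 m2) :
  (m%:R)^-1 *
    (\sum_(k < m) \sum_(l < m | coprime l m)
       ramanujan_sum R m1 k%:Z * ramanujan_sum R m2 (k%:Z + l%:Z - a))
  = if (m1 == m2) && (m2 == m) then (mobius m)%:~R * ramanujan_sum R m a
    else 0 :> R[i].
Proof.
have m0 : (0 < m)%N by rewrite hm lcmn_gt0 hm1.
have m1E : (m1 * (m %/ m1))%N = m by rewrite mulnC divnK // hm dvdn_lcml.
have m2E : (m2 * (m %/ m2))%N = m by rewrite mulnC divnK // hm dvdn_lcmr.
have q10 : (0 < m %/ m1)%N by move: m0; rewrite -{1}m1E muln_gt0 => /andP[].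
have q20 : (0 < m %/ m2)%N by move: m0; rewrite -{1}m2E muln_gt0 => /andP[].
(* If [g] is the gcd of the cofactors, [m / g] is still a common multiple of [m1] and [m2], so
   minimality of the lcm gives [g = 1]. *)
have cq : coprime (m %/ m1) (m %/ m2).
  set q1 := (m %/ m1)%N in m1E q10 *; set q2 := (m %/ m2)%N in m2E *.
  have /dvdnP[r1 r1E] := dvdn_gcdl q1 q2.
  have /dvdnP[r2 r2E] := dvdn_gcdr q1 q2.
  set g := gcdn q1 q2 in r1E r2E *.
  have g0 : (0 < g)%N by rewrite gcdn_gt0 q10.
  have E : (m1 * r1 = m2 * r2)%N.
    by apply/eqP; rewrite -(eqn_pmul2r g0) -!mulnA -r1E -r2E m1E m2E.
  have : (m %| m1 * r1)%N by rewrite hm dvdn_lcm dvdn_mulr //= E dvdn_mulr.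
  have r0 : (0 < r1)%N by move: q10; rewrite r1E muln_gt0 => /andP[].
  rewrite -{1}m1E dvdn_pmul2l // => /(dvdn_leq r0).
  rewrite [X in (X <= _)%N]r1E -{2}[r1]muln1 leq_pmul2l //.
  by rewrite /coprime eqn_leq g0 andbT.
under eq_bigr => k _ do under eq_bigr => l _ do
  rewrite (ramanujan_sum_prim_root R _ hm1 q10)
    (ramanujan_sum_prim_root R _ hm2 q20) m1E m2E.
rewrite (sum_coprime_char_conv a (cexp_prim_root R m0) m1E m2E cq).
case: ifP => _; last by rewrite mulr0.
rewrite mulKf ?pnatr_eq0 -?lt0n //; congr (_ * _).
(* Taking [q = 1] expresses [c_m(a)] through the same root of order [m]. *)
rewrite (ramanujan_sum_prim_root R _ m0 (ltn0Sn 0)) muln1.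
by apply: eq_bigr => j _; rewrite muln1.
Qed.
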